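(* Let $\alpha>0$ and $\varepsilon\in(0,1)$. Let $r_d(T,\phi)$ be the relative loss after $T$ steps of (simplified) sign descent with step-size parameter $\phi\in[1,d]$ on the linear bigram problem with vocabulary size $d$ and power-law frequencies with exponent $\alpha$, as defined in the context. To reach a relative loss of $\varepsilon$, $t$ needs to scale with $d$ as follows: 1. if $\alpha<1/2$, $\ t_d(\varepsilon)=\frac12\,c_2^{\frac{\alpha}{1-2\alpha}}\left(\frac1\varepsilon\right)^{\frac1{2-4\alpha}}$ with $c_2=\frac{\alpha}{1-\alpha}$; 2. if $\alpha=1/2$, $\ t_d(\varepsilon)=\frac12d^{\frac12(1-\varepsilon)}$; 3. if $\alpha>1/2$, $\ t_d(\varepsilon)=\frac12\left(\dfrac{d\,(\frac1\varepsilon-1)}{\zeta(2\alpha)}\right)^{1/2}$. With these scalings there is a choice of step-size parameters $\phi_d(\varepsilon)\in[1,d]$ such that $$\lim_{d\to\infty}r_d\big(t_d(\varepsilon),\phi_d(\varepsilon)\big)=\varepsilon.$$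
   Context: Setting. In the linear bigram problem with vocabulary size $d$ and power-law frequencies, with $z=\sum_{k=1}^dk^{-\alpha}$, the token frequencies are $\pi_k=\frac1{zk^\alpha}$ and, for every $i\in[d]$, the conditional frequencies $\pi_{j|i}$ are, for some permutation $\rho_i$ of $[d]$, $\pi_{\rho_i(k)|i}=\frac1{zk^\alpha}$. The excess loss at parameters $\mathbf W\in\mathbb R^{d\times d}$ is, up to a constant factor irrelevant for ratios, $\sum_{i,j}\pi_i\delta_{ij}^2$, where $\delta_{ij}$ is the distance of $W_{ij}$ to the optimum; initialized at $\mathbf W=0$ one has $\delta_{ij}(0)=\pi_{j|i}$. The simplified sign descent dynamics with step-size $\eta>0$ are $$|\delta_{ij}(t)|=\begin{cases}|\delta_{ij}(0)|-t\eta&\text{if }|\delta_{ij}(t-1)|-\eta\ge0,\\ \eta/2&\text{otherwise.}\end{cases}$$ The step-size is parameterized as $\eta=\frac1{zT\phi^\alpha}$ with $1\le\phi\le d$, where $T$ is the total number of steps. The relative loss (excess loss after $T$ steps divided by initial excess loss) is then $$r_d(T,\phi)=\frac{\sum_{k=1}^{\lfloor\phi\rfloor}\left(k^{-\alpha}-\phi^{-\alpha}\right)^2+\frac{d-\lfloor\phi\rfloor}{4T^2}\phi^{-2\alpha}}{\sum_{k=1}^dk^{-2\alpha}},$$ and this formula defines $r_d(T,\phi)$ for all real $T>0$. $\zeta$ is the Riemann zeta function. *)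

(* Defs.v *)
From mathcomp Require Import all_boot all_order all_algebra.
From mathcomp Require Import all_classical all_reals all_analysis.
Set Implicit Arguments.
Unset Strict Implicit.
Unset Printing Implicit Defensive.
Import Order.TTheory GRing.Theory Num.Theory.
Import numFieldNormedType.Exports.
Local Open Scope classical_set_scope.
Local Open Scope ring_scope.

(* Values of the Riemann zeta function on the real half-line s > 1; for
   s <= 1 the series diverges and [zeta s] carries no meaning. *)
Definition zeta {R : realType} (s : R) : R := limn (series (riemannR s)).

(* Relative loss of simplified sign descent on the linear bigram problem:
   excess loss after T steps of size 1 / (z T phi^alpha), divided by the excess
   loss at W = 0.  Every row of W contributes the same ratio, so the weights
   pi_i and the normalization z cancel.  In a row, the entries of rank
   k <= phi are still decreasing after T steps and are at distance
   (k^-alpha - phi^-alpha) / z from their optimum, while the other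
   d - floor phi entries oscillate at distance phi^-alpha / (2 T z).  That
   reading requires T to be a positive integer; the closed form is the
   definition for every real T > 0. *)
Definition relative_loss {R : realType} (alpha : R) (d : nat) (T phi : R) : R :=
  (\sum_(1 <= k < (Num.truncn phi).+1)
      (k%:R `^ (- alpha) - phi `^ (- alpha)) ^+ 2
   + (d%:R - (Num.truncn phi)%:R) / (4 * T ^+ 2) * phi `^ (- (2 * alpha)))
  / \sum_(1 <= k < d.+1) k%:R `^ (- (2 * alpha)).

Definition time_scaling {R : realType} (alpha eps : R) (d : nat) : R :=
  if alpha < 2^-1 then
    2^-1 * (alpha / (1 - alpha)) `^ (alpha / (1 - 2 * alpha))
         * eps^-1 `^ (2 - 4 * alpha)^-1
  else if alpha == 2^-1 then
    2^-1 * d%:R `^ (2^-1 * (1 - eps))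
  else
    2^-1 * (d%:R * (eps^-1 - 1) / zeta (2 * alpha)) `^ 2^-1.

(* Main.v *)
Require Import Defs.
From mathcomp Require Import all_boot all_order all_algebra.
From mathcomp Require Import all_classical all_reals all_analysis.
From mathcomp Require Import ring lra.
Set Implicit Arguments.
Unset Strict Implicit.
Unset Printing Implicit Defensive.
Import Order.TTheory GRing.Theory Num.Theory.
Import numFieldNormedType.Exports.
Local Open Scope classical_set_scope.
Local Open Scope ring_scope.

(** With x = phi^-alpha and M = 4 T^2, the numerator of the relative loss is
    sum_(k <= phi) (k^-alpha - x)^2 + (d - floor phi) x^2 / M.

    If alpha < 1/2, take phi = tau d: comparing the power sums with integrals, the
    loss tends to an explicit continuous function of tau in (0, 1] which tends to
    infinity at 0.  With c_2 = alpha / (1 - alpha), this function is at most eps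
    at tau = min(1, (eps / c_2)^(1 / (1 - 2 alpha))), where the time scaling gives
    tau M = 1 / c_2 as soon as eps <= c_2; so some tau gives eps exactly.

    If alpha = 1/2, take phi = d^eps: numerator and denominator are eps ln d + O(1)
    and ln d + O(1).

    If alpha > 1/2, take phi constant: the numerator tends to
    sum_k ((k^-alpha - x)_+)^2 + c x^2 with c = zeta(2 alpha) eps / (1 - eps), which
    is continuous in x, equals c >= eps zeta(2 alpha) at x = 1 and, since
    (a - x)_+ <= (1 - x) a for a <= 1, is at most eps zeta(2 alpha) at x = 1 - eps. *)

(** * Power sums: comparison with integrals, asymptotics and convergence *)

Section PowerSums.
Context {R : realType}.
Implicit Types (a x : R) (n : nat).

Definition psum a n : R := \sum_(1 <= k < n.+1) k%:R `^ (- a).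

Lemma psum0 a : psum a 0 = 0.
Proof. by rewrite /psum big_geq. Qed.

Lemma psumS a n : psum a n.+1 = psum a n + n.+1%:R `^ (- a).
Proof. by rewrite /psum big_nat_recr. Qed.

Lemma psum1 a : psum a 1 = 1.
Proof. by rewrite psumS psum0 add0r powR1. Qed.

Lemma psum_exp0 n : psum 0 n = n%:R.
Proof.
elim: n => [|n IH]; first by rewrite psum0.
by rewrite psumS IH oppr0 powRr0 -natr1.
Qed.

Lemma psum_nondecreasing a : nondecreasing_seq (psum a).
Proof. by apply/nondecreasing_seqP => n; rewrite psumS lerDl powR_ge0. Qed.

Lemma psum_gt0 a n : (0 < n)%N -> 0 < psum a n.
Proof.
by move=> n0; apply: lt_le_trans (psum_nondecreasing a n0); rewrite psum1.
Qed.

(** Discrete integral comparison, with [G] as the antiderivative. The first term is split off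
    because at 0 the antiderivatives used later, a logarithm or a possibly negative power, are of no
    use. *)
Lemma psum_telescope_le a (G : nat -> R) n :
  (forall k, (0 < k)%N -> k.+1%:R `^ (- a) <= G k.+1 - G k) -> (0 < n)%N ->
  psum a n <= 1 + (G n - G 1%N).
Proof.
move=> H; case: n => // n _; elim: n => [|n IH].
  by rewrite psum1 subrr addr0.
by rewrite psumS; have := H n.+1 isT; lra.
Qed.

Lemma psum_telescope_ge a (G : nat -> R) n :
  (forall k, (0 < k)%N -> G k.+1 - G k <= k%:R `^ (- a)) ->
  G n.+1 - G 1%N <= psum a n.
Proof.
move=> H; elim: n => [|n IH]; first by rewrite psum0 subrr.
by rewrite psumS; have := H n.+1 isT; lra.
Qed.

(** By the mean value theorem the difference equals [c ^ (- a)] for some c between n and n + 1, and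
    this power is nonincreasing. Exponents above 1 are included, for use in the convergence of the
    zeta series. *)
Lemma powR_step_bounds a n : 0 <= a -> a != 1 -> (0 < n)%N ->
  n.+1%:R `^ (- a) <=
    n.+1%:R `^ (1 - a) / (1 - a) - n%:R `^ (1 - a) / (1 - a)
    <= n%:R `^ (- a).
Proof.
move=> a0 a1 n0.
have n0R : 0 < n%:R :> R by rewrite ltr0n.
have a1' : 1 - a != 0 by rewrite subr_eq0 eq_sym.
have [|||c] := @MVT R (fun x => x `^ (1 - a)) (fun x => (1 - a) * x `^ (1 - a - 1))
    n%:R n.+1%:R _ _ _.
- by rewrite ltr_nat.
- move=> x; rewrite in_itv/= => /andP[nx _].
  by apply: is_derive1_powR; exact: lt_trans n0R nx.
- apply: derivable_within_continuous => x; rewrite in_itv/= => /andP[nx _].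
  by apply: derivable_powR; rewrite in_itv/= andbT (lt_le_trans n0R).
rewrite in_itv/= => /andP[nc cn] E.
have c0 : 0 < c by exact: lt_trans nc.
rewrite -mulrBl E -natr1 [_ + 1 - _]addrAC subrr add0r mulr1 mulrAC divff// mul1r.
rewrite [1 - a - 1]addrAC subrr add0r !powRN.
rewrite !lef_pV2 ?posrE ?powR_gt0//; rewrite ?natr1 ?ltr0n//.
by apply/andP; split; apply: ge0_ler_powR; rewrite ?nnegrE ?natr1 ?ler0n// ltW.
Qed.

Lemma psum_le_powR a x : 0 <= a < 1 -> 1 <= x ->
  psum a (Num.truncn x) <= x `^ (1 - a) / (1 - a).
Proof.
move=> /andP[a0 a1] x1; have x0 : 0 <= x by lra.
have /andP[nx xn] := truncn_itv x0.
have n0 : (0 < Num.truncn x)%N by rewrite truncn_gt0.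
have b0 : 0 < 1 - a by lra.
apply: (@le_trans _ _ ((Num.truncn x)%:R `^ (1 - a) / (1 - a))); last first.
  rewrite ler_pM2r ?invr_gt0//.
  by apply: ge0_ler_powR; rewrite ?nnegrE ?ler0n// ltW.
apply: le_trans (@psum_telescope_le a (fun n => n%:R `^ (1 - a) / (1 - a)) _ _ n0) _.
  by move=> k k0; have /andP[] := @powR_step_bounds a k a0 (negbT (lt_eqF a1)) k0.
have : 1 <= 1 / (1 - a) by rewrite ler_pdivlMr// mul1r; lra.
by rewrite powR1; lra.
Qed.

Lemma psum_ge_powR a x : 0 <= a < 1 -> 1 <= x ->
  (x `^ (1 - a) - 1) / (1 - a) <= psum a (Num.truncn x).
Proof.
move=> /andP[a0 a1] x1; have x0 : 0 <= x by lra.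
have /andP[nx xn] := truncn_itv x0.
have b0 : 0 < 1 - a by lra.
(* The lower comparison runs up to floor x + 1, which exceeds x. *)
apply: le_trans (@psum_telescope_ge a (fun n => n%:R `^ (1 - a) / (1 - a)) _ _).
  rewrite powR1 -mulrBl ler_pM2r ?invr_gt0// lerD2r.
  by apply: ge0_ler_powR; rewrite ?nnegrE ?ler0n// ltW.
by move=> k k0; have /andP[] := @powR_step_bounds a k a0 (negbT (lt_eqF a1)) k0.
Qed.

(** Both bounds are [ln (1 + y) <= y], taken at y = 1/n and at y = -1/(n + 1). *)
Lemma ln_step_bounds n : (0 < n)%N ->
  n.+1%:R `^ (- 1) <= ln (n.+1%:R : R) - ln n%:R <= n%:R `^ (- 1).
Proof.
move=> n0.
have n0R : 0 < n%:R :> R by rewrite ltr0n.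
have n1R : 0 < n.+1%:R :> R by rewrite ltr0n.
rewrite !powR_inv1 ?ler0n// -ln_div ?posrE//.
have -> : n.+1%:R / n%:R = 1 + n%:R^-1 :> R.
  by rewrite -natr1; field; rewrite gt_eqF.
apply/andP; split; last by apply: le_ln1Dx; rewrite (lt_trans (ltrN10 R))// invr_gt0.
have : ln (1 + - n.+1%:R^-1 : R) <= - n.+1%:R^-1.
  by rewrite le_ln1Dx// ltrN2 invf_lt1// ltr1n.
have -> : 1 + - n.+1%:R^-1 = (1 + n%:R^-1)^-1 :> R.
  by rewrite -natr1; field; rewrite natr1 !gt_eqF.
by rewrite lnV ?lerN2// posrE addr_gt0// invr_gt0.
Qed.

Lemma psum_exp1_le_ln x : 1 <= x -> psum 1 (Num.truncn x) <= 1 + ln x.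
Proof.
move=> x1; have x0 : 0 <= x by lra.
have /andP[nx xn] := truncn_itv x0.
have n0 : (0 < Num.truncn x)%N by rewrite truncn_gt0.
apply: le_trans (@psum_telescope_le 1 (fun n => ln n%:R) _ _ n0) _.
  by move=> k k0; have /andP[] := ln_step_bounds k0.
by rewrite ln1 subr0 lerD2l ler_ln// posrE ?ltr0n//; lra.
Qed.

Lemma psum_exp1_ge_ln x : 1 <= x -> ln x <= psum 1 (Num.truncn x).
Proof.
move=> x1; have x0 : 0 <= x by lra.
have /andP[nx xn] := truncn_itv x0.
apply: le_trans (@psum_telescope_ge 1 (fun n => ln n%:R) _ _).
  rewrite ln1 subr0 ler_ln ?posrE ?ltr0n//; first exact: ltW.
  by lra.
by move=> k k0; have /andP[] := ln_step_bounds k0.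
Qed.

Lemma psum_series_riemannR a n : psum a n = series (riemannR a) n.
Proof.
rewrite /psum big_add1/= /series/=.
by apply: eq_bigr => k _; rewrite powRN.
Qed.

Lemma is_cvg_psum a : 1 < a -> cvgn (psum a).
Proof.
move=> a1; apply: nondecreasing_is_cvgn; first exact: psum_nondecreasing.
exists (1 + (a - 1)^-1) => _ [n _ <-].
case: n => [|n]; first by rewrite psum0 addr_ge0// invr_ge0; lra.
apply: le_trans (@psum_telescope_le a (fun n => n%:R `^ (1 - a) / (1 - a)) _ _ _) _ => //.
  move=> k k0.
  have a0 : 0 <= a by lra.
  by have /andP[] := @powR_step_bounds a k a0 (negbT (gt_eqF a1)) k0.
(* As 1 - a < 0, the term at the upper end is nonpositive; only [1 / (a - 1)] remains. *)
rewrite lerD2l powR1 div1r -[a - 1]opprB invrN gerDr.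
by rewrite mulr_ge0_le0 ?powR_ge0// invr_le0; lra.
Qed.

Lemma psum_cvg_zeta a : 1 < a -> psum a @ \oo --> zeta a.
Proof.
move=> a1; have := is_cvg_psum a1.
rewrite (_ : psum a = series (riemannR a))//.
by apply/funext => n; exact: psum_series_riemannR.
Qed.

Lemma psum_le_zeta a n : 1 < a -> psum a n <= zeta a.
Proof.
move=> a1; rewrite -(cvg_lim _ (psum_cvg_zeta a1))//.
by apply: nondecreasing_cvgn_le; [exact: psum_nondecreasing|exact: is_cvg_psum].
Qed.

Lemma powR_cvgy a : 0 < a -> x `^ a @[x --> +oo] --> +oo.
Proof.
move=> a0; apply/cvgryPge => A; near=> x.
apply: (@le_trans _ _ (Num.max A 1)); first by rewrite le_max lexx.
set B := Num.max A 1.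
have B0 : 0 < B by rewrite lt_max ltr01 orbT.
have -> : B = (B `^ a^-1) `^ a.
  by rewrite -powRrM mulVf ?gt_eqF// powRr1// ltW.
have xB : B `^ a^-1 <= x.
  by near: x; apply: nbhs_pinfty_ge; rewrite num_real.
apply: ge0_ler_powR => //; first exact: ltW.
  by rewrite nnegrE powR_ge0.
by rewrite nnegrE (le_trans (powR_ge0 _ _) xB).
Unshelve. all: by end_near. Qed.

Lemma powRN_cvg0 a : 0 < a -> x `^ (- a) @[x --> +oo] --> 0.
Proof.
move=> a0; have -> : (fun x => x `^ (- a)) = (fun x => (x `^ a)^-1).
  by apply/funext => x; rewrite powRN.
apply/gtr0_cvgV0; last exact: powR_cvgy.
by near=> x; rewrite powR_gt0.
Unshelve. all: by end_near. Qed.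

(** Squeeze between the two integral bounds. The case a = 0 says that floor x / x tends to 1, so
    counts of indices need no separate treatment. *)
Lemma psum_trunc_asymptotics a : 0 <= a < 1 ->
  psum a (Num.truncn x) / x `^ (1 - a) @[x --> +oo] --> (1 - a)^-1.
Proof.
move=> a01; have b0 : 0 < 1 - a by move: a01; lra.
apply: (@squeeze_cvgr _ _ _ _ (fun x => (1 - x `^ (- (1 - a))) / (1 - a))
   (cst (1 - a)^-1)).
- near=> x; have x1 : 1 <= x by near: x; apply: nbhs_pinfty_ge; rewrite num_real.
  have p0 : 0 < x `^ (1 - a) by rewrite powR_gt0//; lra.
  rewrite ler_pdivlMr// ler_pdivrMr//=; apply/andP; split.
    apply: le_trans (psum_ge_powR a01 x1).
    by rewrite powRN mulrAC mulrBl mul1r mulVf// gt_eqF.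
  by apply: le_trans (psum_le_powR a01 x1) _; rewrite mulrC.
- rewrite -[X in _ --> X]mul1r -[X in X * _]subr0.
  by apply: cvgMl; apply: cvgB; [exact: cvg_cst|exact: powRN_cvg0].
- exact: cvg_cst.
Unshelve. all: by end_near. Qed.

End PowerSums.

(** * The loss in terms of power sums, and the squared time scalings *)

Section RelativeLoss.
Context {R : realType}.
Implicit Types (alpha eps T phi x p : R).

Lemma powR_sqr x p : (x `^ p) ^+ 2 = x `^ (2 * p).
Proof. by rewrite -powR_mulrn ?powR_ge0// -powRrM mulrC. Qed.

Lemma powRN_sqr x p : x `^ (- (2 * p)) = (x `^ (- p)) ^+ 2.
Proof. by rewrite powR_sqr mulrN. Qed.

Lemma relative_lossE alpha (d : nat) T phi (n := Num.truncn phi)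
    (x := phi `^ (- alpha)) :
  relative_loss alpha d T phi =
    (psum (2 * alpha) n - 2 * x * psum alpha n + n%:R * x ^+ 2
      + (d%:R - n%:R) / (4 * T ^+ 2) * x ^+ 2) / psum (2 * alpha) d.
Proof.
rewrite /relative_loss -/(psum (2 * alpha) d) powRN_sqr -/n -/x.
congr ((_ + _) / _).
elim: n => [|n IH]; first by rewrite !psum0 big_geq// mulr0 mul0r subrr addr0.
by rewrite big_nat_recr//= IH !psumS -natr1 powRN_sqr natr1; ring.
Qed.

(** The loss depends on the number of steps only through [4 * T ^+ 2]; this lemma and the next two
    evaluate that quantity in the three regimes. *)
Lemma sqr_time_lt_half alpha eps (d : nat) : alpha < 2^-1 ->
  4 * time_scaling alpha eps d ^+ 2 =
  (alpha / (1 - alpha)) `^ (2 * alpha / (1 - 2 * alpha))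
    * eps^-1 `^ (1 - 2 * alpha)^-1.
Proof.
move=> a12; rewrite /time_scaling a12 !exprMn !powR_sqr.
have b0 : 1 - 2 * alpha != 0 by apply/eqP; lra.
have -> : 2 * (2 - 4 * alpha)^-1 = (1 - 2 * alpha)^-1.
  by field; rewrite b0/=; apply/eqP; lra.
by rewrite [2 * (alpha / _)]mulrA; field.
Qed.

Lemma sqr_time_half eps (d : nat) :
  4 * time_scaling 2^-1 eps d ^+ 2 = d%:R `^ (1 - eps).
Proof.
rewrite /time_scaling ltxx eqxx exprMn powR_sqr.
by rewrite [2 * (2^-1 * _)]mulrA divff// mul1r; field.
Qed.

Lemma sqr_time_gt_half alpha eps (d : nat) : 2^-1 < alpha -> 0 < eps < 1 ->
  4 * time_scaling alpha eps d ^+ 2 = d%:R * (eps^-1 - 1) / zeta (2 * alpha).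
Proof.
move=> a12 /andP[e0 e1]; rewrite /time_scaling ltNge ltW//= gt_eqF//.
rewrite exprMn powR_sqr divff// powRr1.
  by rewrite mulrA -[RHS]mul1r; congr (_ * _); field.
(* Squaring the square root requires a nonnegative radicand; zeta is at least its first partial sum,
   1. *)
have z1 : 1 <= zeta (2 * alpha).
  by have := @psum_le_zeta R (2 * alpha) 1; rewrite psum1; apply; lra.
rewrite mulr_ge0 ?invr_ge0//; last by lra.
by rewrite mulr_ge0// subr_ge0 ltW// invf_gt1.
Qed.

End RelativeLoss.

(** * The critical exponent 1/2 *)

Section HalfExponent.
Context {R : realType}.
Implicit Types (eps : R).

Lemma ln_cvgy : ln x @[x --> (+oo : set_system R)] --> +oo.
Proof.
apply/cvgryPge => A; near=> x.
have Ax : expR A <= x by near: x; apply: nbhs_pinfty_ge; rewrite num_real.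
have x0 : 0 < x by apply: lt_le_trans Ax; exact: expR_gt0.
by rewrite -(expRK A) ler_ln// posrE expR_gt0.
Unshelve. all: by end_near. Qed.

(** Multiply the error by [psum 1 d]. The leading difference [psum 1 n - eps * psum 1 d] lies in
    [-1, 1], the subtracted cross term in [0, 4] and the two other terms in [0, 1], so the total
    lies in [-5, 3]. Finally [psum 1 d] is at least ln d. *)
Lemma relative_loss_half_bounds eps (d : nat) : 0 < eps < 1 -> (1 < d)%N ->
  `|relative_loss 2^-1 d (time_scaling 2^-1 eps d) (d%:R `^ eps) - eps|
    <= 5 / ln d%:R.
Proof.
move=> /andP[e0 e1] d1.
have dR : 1 < d%:R :> R by rewrite ltr1n.
set L := ln d%:R; have L0 : 0 < L by rewrite ln_gt0.
set phi := d%:R `^ eps.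
have phi1 : 1 <= phi by rewrite -(powRr0 d%:R); apply: ler_powR; lra.
have phi0 : 0 < phi by lra.
rewrite relative_lossE sqr_time_half divff//.
set n := Num.truncn phi; set x := phi `^ (- 2^-1).
have lnphi : ln phi = eps * L by rewrite ln_powR.
have x2 : x ^+ 2 = phi^-1 by rewrite powR_sqr mulrN divff// powR_inv1// (ltW phi0).
have /andP[nphi _] : n%:R <= phi < n.+1%:R by apply: truncn_itv; lra.
(* This is what the choice of phi buys: 4 T^2 phi = d, so the oscillating entries contribute (d - n)
   / d. *)
have phid : phi * d%:R `^ (1 - eps) = d%:R.
  rewrite -powRD; first by rewrite addrC subrK powRr1.
  by apply/implyP => _; rewrite gt_eqF//; lra.
have phi_le_d : phi <= d%:R.
  by rewrite -[leRHS]powRr1 ?ler0n//; apply: ler_powR; lra.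
have mid : 0 <= 2 * x * psum 2^-1 n <= 4.
  have p0 : 0 <= psum (2^-1 : R) n.
    by rewrite -(psum0 (2^-1 : R)); apply: psum_nondecreasing.
  rewrite mulr_ge0 ?mulr_ge0 ?powR_ge0//=.
  have := @psum_le_powR R 2^-1 phi.
  have -> : 1 - 2^-1 = 2^-1 :> R by lra.
  move=> /(_ _ phi1) -/(_ ltac:(lra)) pn.
  have xphi : x * phi `^ 2^-1 = 1 by rewrite /x powRN mulVf// gt_eqF// powR_gt0.
  have : x * psum 2^-1 n <= x * (phi `^ 2^-1 / 2^-1) by rewrite ler_wpM2l ?powR_ge0.
  by rewrite mulrA xphi invrK; lra.
have third : 0 <= n%:R * x ^+ 2 <= 1.
  by rewrite x2 mulr_ge0 ?invr_ge0 ?(ltW phi0)//= ler_pdivrMr// mul1r.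
have fourth : 0 <= (d%:R - n%:R) / d%:R `^ (1 - eps) * x ^+ 2 <= 1.
  rewrite x2 -mulrA -invfM [_ `^ _ * _]mulrC phid.
  have d0 : 0 < d%:R :> R by lra.
  rewrite ler_pdivrMr// mul1r lerBlDr lerDl ler0n andbT.
  by rewrite divr_ge0// subr_ge0 (le_trans nphi).
have := psum_exp1_le_ln phi1; have := psum_exp1_ge_ln phi1; rewrite -/n lnphi => p1 p2.
have q1 : L <= psum 1 d.
  by have := psum_exp1_ge_ln (ltW dR); rewrite natrK.
have q2 : psum 1 d <= 1 + L.
  by have := psum_exp1_le_ln (ltW dR); rewrite natrK.
have q0 : 0 < psum (1 : R) d by lra.
apply: (@le_trans _ _ (5 / psum 1 d)); last first.
  by rewrite ler_pM2l// lef_pV2.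
rewrite -[X in _ - X](mulfK (lt0r_neq0 q0)) -mulrBl normrM.
rewrite [X in _ * X]gtr0_norm ?invr_gt0// ler_pM2r ?invr_gt0//.
have eq1 : eps * L <= eps * psum 1 d by rewrite ler_pM2l.
have eq2 : eps * psum 1 d <= eps * L + 1.
  apply: (@le_trans _ _ (eps * (1 + L))); first by rewrite ler_pM2l.
  by lra.
by rewrite ler_norml; apply/andP; split; lra.
Qed.

Lemma relative_loss_half_cvg eps : 0 < eps < 1 ->
  (fun d : nat => relative_loss 2^-1 d (time_scaling 2^-1 eps d) (d%:R `^ eps))
    @ \oo --> eps.
Proof.
move=> e01.
have Linf : (5 / ln (d%:R : R)) @[d --> \oo] --> 0.
  rewrite -[X in _ --> X](mulr0 5); apply: cvgMr.
  apply/gtr0_cvgV0; last exact: cvg_comp cvgr_idn ln_cvgy.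
  near=> d; rewrite ln_gt0// ltr1n; near: d; exact: nbhs_infty_gt.
apply/cvgrPdist_le => e e0.
near=> d; rewrite distrC.
apply: le_trans (@relative_loss_half_bounds eps d e01 _) _.
  by near: d; exact: nbhs_infty_gt.
apply: le_trans (ler_norm _) _; rewrite -[X in `|X|]subr0 distrC.
by near: d; move/cvgrPdist_le : Linf; apply.
Unshelve. all: by end_near. Qed.

End HalfExponent.

(** * Exponents below 1/2 *)

Section SmallExponent.
Context {R : realType}.
Implicit Types (alpha eps tau M x p : R).

(** Limit of the loss at phi = tau d with M = 4 T^2. The coefficient of the first power is [1 / (1 -
    2 * alpha) - 2 / (1 - alpha) + 1], from expanding the square; the last factor comes from the
    asymptotics of the denominator. *)
Definition limit_loss alpha M tau : R :=
  (tau `^ (1 - 2 * alpha) * (2 * alpha ^+ 2 / ((1 - alpha) * (1 - 2 * alpha)))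
   + (1 - tau) / M * tau `^ (- (2 * alpha))) * (1 - 2 * alpha).

Lemma powR1B x p : 0 < x -> x `^ (1 - p) = x * x `^ (- p).
Proof.
move=> x0; rewrite powRD ?powRr1 ?ltW//.
by apply/implyP => _; rewrite gt_eqF.
Qed.

(** Once tau d >= 1, the loss is exactly the expression [v] in the normalized sums [q], each of
    which converges. The maximum with 1 only matters for small d. *)
Lemma relative_loss_scaled_cvg alpha (T : R) tau : 0 < alpha < 2^-1 -> T != 0 ->
  0 < tau <= 1 ->
  (fun d : nat => relative_loss alpha d T (Num.max 1 (tau * d%:R)))
    @ \oo --> limit_loss alpha (4 * T ^+ 2) tau.
Proof.
move=> /andP[a0 a12] T0 /andP[t0 t1].
pose phi (d : nat) : R := tau * d%:R.
pose q (a x : R) := psum a (Num.truncn x) / x `^ (1 - a).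
pose M := 4 * T ^+ 2.
have M0 : M != 0 by rewrite mulf_neq0// expf_neq0.
pose v (d : nat) : R :=
  (tau `^ (1 - 2 * alpha) *
    (q (2 * alpha) (phi d) - 2 * q alpha (phi d) + q 0 (phi d))
   + (1 - tau * q 0 (phi d)) / M * tau `^ (- (2 * alpha)))
  * (q (2 * alpha) d%:R)^-1.
have phiy : phi @ \oo --> +oo.
  apply: (cvg_comp _ (fun x => tau * x) cvgr_idn).
  exact: gt0_cvgMry t0 cvg_id.
have qphi a : 0 <= a < 1 -> (fun d => q a (phi d)) @ \oo --> (1 - a)^-1.
  by move=> a01; apply: cvg_comp phiy _; exact: psum_trunc_asymptotics.
have q2 : (fun d : nat => q (2 * alpha) d%:R) @ \oo --> (1 - 2 * alpha)^-1.
  by apply: (cvg_comp _ _ cvgr_idn); apply: psum_trunc_asymptotics; lra.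
have h1 : 1 - alpha != 0 by apply/eqP; lra.
have h2 : 1 - 2 * alpha != 0 by apply/eqP; lra.
have vcvg : v @ \oo --> limit_loss alpha M tau.
  have -> : limit_loss alpha M tau =
    (tau `^ (1 - 2 * alpha) *
      ((1 - 2 * alpha)^-1 - 2 * (1 - alpha)^-1 + (1 - 0)^-1)
     + (1 - tau * (1 - 0)^-1) / M * tau `^ (- (2 * alpha)))
    * (1 - 2 * alpha)^-1^-1.
    rewrite /limit_loss subr0 invr1 mulr1 invrK; congr ((_ * _ + _) * _).
    by field; rewrite h1 h2.
  apply: cvgM; last by apply: cvgV => //; rewrite invr_neq0.
  apply: cvgD.
    apply: cvgMr; apply: cvgD; last by apply: qphi; lra.
    apply: cvgB; first by apply: qphi; lra.
    by apply: cvgMr; apply: qphi; lra.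
  apply: cvgMl; apply: cvgMl; apply: cvgB; first exact: cvg_cst.
  by apply: cvgMr; apply: qphi; lra.
apply: cvg_trans vcvg; apply: near_eq_cvg.
near=> d.
have d0 : 0 < d%:R :> R by rewrite ltr0n; near: d; exact: nbhs_infty_gt.
have phi1 : 1 <= phi d.
  by rewrite /phi mulrC -ler_pdivrMr//; near: d; exact: nbhs_infty_ger.
rewrite -/(phi d) (max_idPr phi1) relative_lossE.
have phi0 : 0 < phi d by lra.
rewrite /v /q natrK psum_exp0 subr0 (powRr1 (ltW phi0)) -/M.
rewrite !powR1B// !powRN_sqr -/(phi d).
set n := Num.truncn (phi d); set P := psum (2 * alpha) d.
have P0 : P != 0 by rewrite lt0r_neq0// psum_gt0// -(ltr0n R).
have := powR_gt0 (- alpha) d0; have := powR_gt0 (- alpha) t0.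
(* After this factorization every power is expressed through [s] and [D], and the goal is a rational
   identity. *)
have -> : phi d `^ (- alpha) = tau `^ (- alpha) * d%:R `^ (- alpha).
  by rewrite powRM// ltW.
rewrite /phi; set s := tau `^ _; set D := d%:R `^ _ => s0 D0.
by field; rewrite M0 P0 !gt_eqF.
Unshelve. all: by end_near. Qed.

Lemma exists_limit_loss_eq alpha eps
    (M := (alpha / (1 - alpha)) `^ (2 * alpha / (1 - 2 * alpha))
          * eps^-1 `^ (1 - 2 * alpha)^-1) :
  0 < alpha < 2^-1 -> 0 < eps ->
  exists2 tau, 0 < tau <= 1 & limit_loss alpha M tau = eps.
Proof.
move=> /andP[a0 a12] e0.
have b0 : 0 < 1 - 2 * alpha by lra.
have a1 : 0 < 1 - alpha by lra.
set c := alpha / (1 - alpha) in M *.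
have c0 : 0 < c by rewrite divr_gt0.
have M0 : 0 < M by rewrite mulr_gt0// powR_gt0// invr_gt0.
set h := limit_loss alpha M.
pose K := 2 * alpha ^+ 2 / ((1 - alpha) * (1 - 2 * alpha)).
have K0 : 0 <= K by rewrite divr_ge0 ?mulr_ge0 ?sqr_ge0//; lra.
have Kc : K * (1 - 2 * alpha) = 2 * alpha * c.
  by rewrite /K /c; field; apply/andP; split; apply/eqP; lra.
have [tau1 /andP[tau1_0 tau1_1] htau1] : exists2 t, 0 < t <= 1 & h t <= eps.
  have [ec|ec] := leP eps c; last first.
    (* For c < eps the endpoint suffices: the oscillation term vanishes and 2 alpha c <= c < eps
       remains. *)
    exists 1; first by rewrite ltr01 lexx.
    rewrite /h /limit_loss powR1 subrr !mul0r addr0 mul1r -/K Kc.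
    have : 2 * alpha * c <= c by rewrite ler_piMl//; lra.
    by lra.
  pose t := (eps / c) `^ (1 - 2 * alpha)^-1.
  have ec0 : 0 < eps / c by rewrite divr_gt0.
  have t0 : 0 < t by rewrite powR_gt0.
  have tb : t `^ (1 - 2 * alpha) = eps / c.
    by rewrite -powRrM mulVf ?gt_eqF// powRr1 ?ltW.
  have tM : t * M = c^-1.
    have E2 : 2 * alpha = 1 - (1 - 2 * alpha) by lra.
    rewrite /t /M powRrM -!powRM ?mulr_ge0 ?powR_ge0 ?invr_ge0 ?(ltW c0) ?(ltW e0)//.
    have -> : eps / c * (c `^ (2 * alpha) / eps) = c `^ (- (1 - 2 * alpha)).
      by rewrite [in LHS]E2 powR1B//; field; rewrite !gt_eqF.
    by rewrite -powRrM mulNr divff ?gt_eqF// powR_inv1// ltW.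
  have ht : t `^ (1 - 2 * alpha) = t * t `^ (- (2 * alpha)) by exact: powR1B.
  exists t.
    rewrite t0 /t -[leRHS](powRr0 (eps / c)) ger_powR ?ec0/= ?invr_ge0 ?(ltW b0)//.
    by rewrite ler_pdivrMr// mul1r.
  (* With 1 - t replaced by 1 the loss at t is exactly eps: the first term gives 2 alpha eps and the
     second (1 - 2 alpha) eps. Restoring 1 - t only decreases it. *)
  have -> : eps = (t `^ (1 - 2 * alpha) * K + M^-1 * t `^ (- (2 * alpha)))
                  * (1 - 2 * alpha).
    have -> : M^-1 = c * t by rewrite -[c]invrK -tM; field; rewrite !gt_eqF.
    rewrite -[c * t * _]mulrA -ht tb mulrDl -[_ * K * _]mulrA Kc.
    by field; rewrite gt_eqF.
  rewrite /h /limit_loss -/K ler_pM2r// lerD2l ler_wpM2r ?powR_ge0//.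
  by rewrite ler_pdivrMr// mulVf ?gt_eqF// gerBl ltW.
(* For tau <= 1/2, the oscillation term alone reaches eps as soon as [tau ^ (- 2 alpha)] is at least
   [B]; [tau0] is small enough for both. *)
pose B := 2 * M * eps / (1 - 2 * alpha).
have B0 : 0 < B by apply: divr_gt0 => //; apply: mulr_gt0 => //; exact: mulr_gt0.
pose tau0 := Num.min tau1 (Num.min 2^-1 (B `^ (- (2 * alpha)^-1))).
have tau0_0 : 0 < tau0 by rewrite !lt_min tau1_0 powR_gt0//= andbT invr_gt0.
have tau01 : tau0 <= tau1 by rewrite ge_min lexx.
have tau0_half : tau0 <= 2^-1 by rewrite !ge_min lexx orbT.
have tau0B : tau0 <= B `^ (- (2 * alpha)^-1) by rewrite !ge_min lexx !orbT.
have htau0 : eps <= h tau0.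
  have sB : B <= tau0 `^ (- (2 * alpha)).
    have -> : B = (B `^ (- (2 * alpha)^-1)) `^ (- (2 * alpha)).
      by rewrite -powRrM mulrNN mulVf ?powRr1// ?ltW//; apply/eqP; lra.
    rewrite !(powRN _ (2 * alpha)) lef_pV2 ?posrE ?powR_gt0//.
    by apply: ge0_ler_powR; rewrite ?nnegrE ?powR_ge0//; lra.
  have -> : eps = 2^-1 / M * B * (1 - 2 * alpha).
    by rewrite /B; field; rewrite !gt_eqF.
  rewrite /h /limit_loss ler_pM2r//.
  apply: le_trans (_ : (1 - tau0) / M * tau0 `^ (- (2 * alpha)) <= _); last first.
    by rewrite lerDr mulr_ge0 ?powR_ge0.
  apply: ler_pM => //; [by rewrite divr_ge0// ltW|exact: ltW|].
  by rewrite ler_pM2r ?invr_gt0//; lra.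
have [|||tau] := @IVT R h tau0 tau1 eps.
- exact: tau01.
- apply: continuous_in_subspaceT => t; rewrite inE/= in_itv/= => /andP[tt0 _].
  have t0 : 0 < t by lra.
  have pc p : {for t, continuous (fun x : R => x `^ p)}.
    apply: differentiable_continuous; apply/derivable1_diffP.
    by apply: derivable_powR; rewrite in_itv/= andbT.
  apply: cvgMl; apply: cvgD; first by apply: cvgMl; exact: pc.
  apply: cvgM; last exact: pc.
  by apply: cvgMl; apply: cvgB; [exact: cvg_cst|exact: cvg_id].
- by rewrite ge_min htau1 orbT/= le_max htau0.
rewrite in_itv/= => /andP[tt0 tt1] ht; exists tau => //.
by rewrite (lt_le_trans tau0_0 tt0) (le_trans tt1 tau1_1).
Qed.

Lemma relative_loss_lt_half_cvg alpha eps : 0 < alpha < 2^-1 -> 0 < eps < 1 ->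
  exists phi : nat -> R,
    (forall d : nat, (1 <= d)%N -> 1 <= phi d <= d%:R) /\
    (fun d : nat => relative_loss alpha d (time_scaling alpha eps d) (phi d))
      @ \oo --> eps.
Proof.
move=> a012 /andP[e0 _]; have /andP[a0 a12] := a012.
have [tau t01 tauE] := exists_limit_loss_eq a012 e0.
exists (fun d => Num.max 1 (tau * d%:R)); split=> [d d1|].
  move: t01 => /andP[t0 t1].
  by rewrite le_max lexx/= ge_max ler1n d1/= ler_piMl.
(* In this regime the number of steps does not depend on d, so T can be held fixed in the limit. *)
have timeE d : time_scaling alpha eps d = time_scaling alpha eps 0.
  by rewrite /time_scaling a12.
have T0 : time_scaling alpha eps 0 != 0.
  rewrite /time_scaling a12 !mulf_neq0// gt_eqF// powR_gt0 ?invr_gt0//.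
  by rewrite divr_gt0//; lra.
under eq_cvg do rewrite timeE.
by have := relative_loss_scaled_cvg a012 T0 t01; rewrite sqr_time_lt_half// tauE.
Qed.

End SmallExponent.

(** * Exponents above 1/2 *)

Section LargeExponent.
Context {R : realType}.
Implicit Types (alpha eps x p : R).

Lemma powRN_le1 x p : 1 <= x -> 0 <= p -> x `^ (- p) <= 1.
Proof.
by move=> x1 p0; rewrite -[leRHS](powRr0 x) ler_powR// oppr_le0.
Qed.

(** Clipping at 0 replaces the cutoff k <= phi, so that the summation range is fixed and the sum is
    continuous in x = phi^-alpha. *)
Definition clipped_loss alpha (N : nat) (x : R) : R :=
  \sum_(1 <= k < N.+1) Num.max (k%:R `^ (- alpha) - x) 0 ^+ 2.

Lemma continuous_clipped_loss alpha N : continuous (clipped_loss alpha N).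
Proof.
apply: continuous_big; first exact: add_continuous.
move=> k _ x; apply: (@continuous_comp _ _ _
  (fun y => Num.max (k%:R `^ (- alpha) - y) 0) (fun y => y ^+ 2)); last first.
  exact: exprn_continuous.
apply: continuous_max; last exact: cvg_cst.
by apply: cvgB; [exact: cvg_cst|exact: cvg_id].
Qed.

Lemma clipped_loss_at1 alpha N : 0 <= alpha -> clipped_loss alpha N 1 = 0.
Proof.
move=> a0; rewrite /clipped_loss big_nat big1// => k /andP[k1 _].
by rewrite max_r ?expr0n// subr_le0 powRN_le1// ler1n.
Qed.

Lemma clipped_loss_le alpha N x : 0 <= alpha -> 0 <= x <= 1 ->
  clipped_loss alpha N x <= (1 - x) ^+ 2 * psum (2 * alpha) N.
Proof.
move=> a0 /andP[x0 x1]; rewrite /psum mulr_sumr.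
apply: ler_sum_nat => k /andP[k1 _].
rewrite powRN_sqr -exprMn; set a := k%:R `^ _.
have a01 : 0 <= a <= 1.
  by rewrite powR_ge0/= powRN_le1// ler1n.
rewrite lerXn2r ?nnegrE ?le_max ?lexx ?orbT//; first by rewrite mulr_ge0//; lra.
by rewrite ge_max; apply/andP; split; nra.
Qed.

Lemma clipped_loss_trunc alpha N (phi : R) : 0 < alpha -> 1 <= phi ->
  (Num.truncn phi <= N)%N ->
  clipped_loss alpha N (phi `^ (- alpha)) =
  \sum_(1 <= k < (Num.truncn phi).+1) (k%:R `^ (- alpha) - phi `^ (- alpha)) ^+ 2.
Proof.
move=> a0 p1 nN; rewrite /clipped_loss (@big_cat_nat _ _ _ (Num.truncn phi).+1)//=.
have p0 : 0 <= phi by lra.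
rewrite [X in _ + X]big_nat [X in _ + X]big1 ?addr0; last first.
  move=> k /andP[kn _].
  have phik : phi < k%:R by rewrite -truncn_lt_nat.
  rewrite max_r ?expr0n// subr_le0 !powRN lef_pV2 ?posrE ?powR_gt0//; try lra.
  by apply: ge0_ler_powR; rewrite ?nnegrE ?ler0n//; lra.
apply: eq_big_nat => k /andP[k1 kn].
have k0 : 0 < k%:R :> R by rewrite ltr0n.
have kphi : k%:R <= phi by rewrite -truncn_ge_nat.
rewrite max_l// subr_ge0 !powRN lef_pV2 ?posrE ?powR_gt0//; try lra.
by apply: ge0_ler_powR; rewrite ?nnegrE ?ler0n//; lra.
Qed.

(** The left side is the limit of the numerator for fixed phi, since d / (4 T^2) equals
    [zeta (2 * alpha) / (eps^-1 - 1)]. The equation is solved for x = phi^-alpha in [1 - eps, 1] by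
    the intermediate value theorem. *)
Lemma exists_phi_gt_half alpha eps : 2^-1 < alpha -> 0 < eps < 1 ->
  exists2 phi : R, 1 <= phi &
  \sum_(1 <= k < (Num.truncn phi).+1) (k%:R `^ (- alpha) - phi `^ (- alpha)) ^+ 2
   + zeta (2 * alpha) / (eps^-1 - 1) * phi `^ (- (2 * alpha))
   = eps * zeta (2 * alpha).
Proof.
move=> a12 /andP[e0 e1]; set z := zeta _.
have a0 : 0 < alpha by lra.
have z1 : 1 <= z.
  by have := @psum_le_zeta R (2 * alpha) 1; rewrite psum1; apply; lra.
set c := z / (eps^-1 - 1).
have Ec : c = eps * z / (1 - eps).
  rewrite /c; field; apply/andP; split; first by apply/eqP; lra.
  by apply/eqP; lra.
(* Largest cutoff floor phi that can occur for x in [1 - eps, 1]. *)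
pose N := Num.truncn ((1 - eps) `^ (- alpha^-1)).
pose f x := clipped_loss alpha N x + c * x ^+ 2.
have c0 : 0 <= c by rewrite Ec divr_ge0 ?mulr_ge0//; lra.
have f1 : eps * z <= f 1.
  rewrite /f clipped_loss_at1 ?(ltW a0)// add0r expr1n mulr1 Ec ler_pdivlMr; last lra.
  by rewrite ler_piMr ?mulr_ge0 ?(ltW e0)//; lra.

have fe : f (1 - eps) <= eps * z.
  have /= := @clipped_loss_le alpha N (1 - eps) (ltW a0) ltac:(lra).
  have := @psum_le_zeta R (2 * alpha) N ltac:(lra); rewrite -/z => Pz.
  have : (1 - (1 - eps)) ^+ 2 * psum (2 * alpha) N <= eps ^+ 2 * z.
    by rewrite opprB addrC subrK ler_wpM2l ?sqr_ge0.
  (* The two summands bound the clipped sum and equal the oscillation term at x = 1 - eps. *)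
  have -> : eps * z = eps ^+ 2 * z + c * (1 - eps) ^+ 2.
    by rewrite Ec; field; apply/eqP; lra.
  by rewrite /f; lra.
have [|||x] := @IVT R f (1 - eps) 1 (eps * z).
- by lra.
- apply: continuous_subspaceT => x; apply: cvgD; first exact: continuous_clipped_loss.
  by apply: cvgMr; exact: exprn_continuous.
- by rewrite ge_min fe/= le_max f1 orbT.
rewrite in_itv/= => /andP[xe x1] fx.
have x0 : 0 < x by lra.
exists (x `^ (- alpha^-1)).
  by rewrite -(powRr0 x); apply: ger_powR; rewrite ?x0// oppr_le0 invr_ge0 ltW.
have xE : (x `^ (- alpha^-1)) `^ (- alpha) = x.
  by rewrite -powRrM mulrNN mulVf ?gt_eqF// powRr1 ?ltW.
rewrite -(@clipped_loss_trunc alpha N)// ?(@powRN_sqr R) ?xE//.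
- by rewrite -(powRr0 x); apply: ger_powR; rewrite ?x0// oppr_le0 invr_ge0 ltW.
- apply: le_truncn; rewrite !powRN lef_pV2 ?posrE ?powR_gt0//; try lra.
  by apply: ge0_ler_powR; rewrite ?nnegrE ?invr_ge0//; lra.
Qed.

Lemma relative_loss_gt_half_cvg alpha eps : 2^-1 < alpha -> 0 < eps < 1 ->
  exists phi : nat -> R,
    (forall d : nat, (1 <= d)%N -> 1 <= phi d <= d%:R) /\
    (fun d : nat => relative_loss alpha d (time_scaling alpha eps d) (phi d))
      @ \oo --> eps.
Proof.
move=> a12 e01; have [phi phi1 phiE] := exists_phi_gt_half a12 e01.
have a1 : 1 < 2 * alpha by lra.
move: e01 => /andP[e0 e1].
have z1 : 1 <= zeta (2 * alpha).
  by have := @psum_le_zeta R (2 * alpha) 1; rewrite psum1; apply; lra.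
(* The minimum keeps the parameter in [1, d] for small d; eventually it is the constant phi. *)
exists (fun d => Num.min phi d%:R); split=> [d d1|].
  by rewrite ge_min lexx orbT andbT le_min phi1 ler1n.
set S := (X in X + _) in phiE; set n := Num.truncn phi.
move: z1 phiE (psum_cvg_zeta a1); set z := zeta (2 * alpha) => z1 phiE cvgz.
pose v (d : nat) : R := (S + (1 - n%:R / d%:R) * (z / (eps^-1 - 1)) *
  phi `^ (- (2 * alpha))) / psum (2 * alpha) d.
have d0 : (fun d : nat => (d%:R : R)^-1) @ \oo --> (0 : R).
  apply/gtr0_cvgV0; last exact: cvgr_idn.
  by near=> d; rewrite ltr0n; near: d; exact: nbhs_infty_gt.
have vcvg : v @ \oo --> eps.
  (* Writing eps as eps z / z exposes the numerator's limit, which [phiE] identifies. *)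
  rewrite -[X in _ --> X](@mulfK _ z); last by apply/eqP; lra.
  rewrite -phiE; apply: cvgM; last by apply: cvgV => //; apply/eqP; lra.
  apply: cvgD; first exact: cvg_cst.
  apply: cvgMl; rewrite -[X in _ --> X]mul1r; apply: cvgMl.
  rewrite -[X in _ --> X]subr0; apply: cvgB; first exact: cvg_cst.
  by rewrite -(mulr0 n%:R); apply: cvgMr.
apply: cvg_trans vcvg; apply: near_eq_cvg.
near=> d.
have pd : phi <= d%:R by near: d; exact: nbhs_infty_ger.
have dR : 0 < d%:R :> R by lra.
rewrite (min_idPl pd) /relative_loss sqr_time_gt_half ?e0//.
rewrite /v -/(psum (2 * alpha) d) -/z -/n; congr ((_ + _ * _) / _).
field; rewrite -/z; apply/and4P; split; apply/eqP; lra.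
Unshelve. all: by end_near. Qed.

End LargeExponent.

Theorem propositionE2 (R : realType) (alpha eps : R) :
  0 < alpha -> 0 < eps < 1 ->
  exists phi : nat -> R,
    (forall d : nat, (1 <= d)%N -> 1 <= phi d <= d%:R) /\
    (fun d : nat => relative_loss alpha d (time_scaling alpha eps d) (phi d))
      @ \oo --> eps.
Proof.
move=> a0 e01; have [a12|a12|->] := ltgtP alpha 2^-1.
- by apply: relative_loss_lt_half_cvg => //; rewrite a0.
- exact: relative_loss_gt_half_cvg.
- exists (fun d => d%:R `^ eps); split; last exact: relative_loss_half_cvg.
  move: e01 => /andP[e0 e1] d d1; have dR : 1 <= d%:R :> R by rewrite ler1n.
  apply/andP; split.
    by rewrite -[leLHS](powRr0 d%:R) ler_powR// ltW.
  by rewrite -[leRHS]powRr1 ?ler0n// ler_powR// ltW.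
Qed.
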